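(* Let $X$ be a compact metrizable space and let $A\subseteq C_p(X)$ be pointwise bounded. The following are equivalent: (i) $A$ is relatively compact in $B_1(X)$; (ii) $A$ has BFT-NIP; (iii) $A$ has countable NIP; (iv) $A$ has finitary NIP.
   Context: $C_p(X)$ is the space of continuous real functions on $X$ with the topology of pointwise convergence; $B_1(X)$ is the space of Baire class 1 functions $X\to\mathbb{R}$ (pointwise limits of sequences of continuous functions) with the topology of pointwise convergence; ''relatively compact in $B_1(X)$'' means the closure of $A$ in $B_1(X)$ is compact. $A$ is pointwise bounded if for each $x\in X$ there is $M_x\ge0$ with $|f(x)|\le M_x$ for all $f\in A$. For $f\in\mathbb{R}^X$, $a\in\mathbb{R}$: $X^f_{\le a}=f^{-1}(-\infty,a]$, $X^f_{\ge a}=f^{-1}[a,\infty)$; for $B\subseteq\mathbb{R}^X$: $X^B_{\le a}=\bigcap_{f\in B}X^f_{\le a}$, $X^B_{\ge a}=\bigcap_{f\in B}X^f_{\ge a}$, with $X^\emptyset_{\le a}=X^\emptyset_{\ge a}=X$. For a sequence $(f_n)$ and $I\subseteq\mathbb{N}$, $f_I=\{f_i:i\in I\}$, $I^{\complement}=\mathbb{N}\setminus I$. $A$ has finitary NIP if for every sequence $(f_n)\subseteq A$ and reals $a<b$ there are finite disjoint $E,F\subseteq\mathbb{N}$ with $X^{f_E}_{\le a}\cap X^{f_F}_{\ge b}=\emptyset$; countable NIP is the same with $E,F$ arbitrary (possibly infinite) disjoint subsets of $\mathbb{N}$; BFT-NIP is the same with the requirement $F=E^{\complement}$ (i.e. there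 is $I\subseteq\mathbb{N}$ with $X^{f_I}_{\le a}\cap X^{f_{I^{\complement}}}_{\ge b}=\emptyset$). *)

(* Defs.v *)
From HB Require Import structures.
From mathcomp Require Import all_boot all_order all_algebra.
From mathcomp Require Import all_classical all_reals all_analysis.

Set Implicit Arguments.
Unset Strict Implicit.
Unset Printing Implicit Defensive.

Import Order.TTheory GRing.Theory Num.Theory.
Import numFieldNormedType.Exports.

Local Open Scope classical_set_scope.
Local Open Scope ring_scope.

(* The axioms on d are those of the library's factory isMetric; nonnegativity
   of d follows from them. *)
Definition metrizable (R : realType) (X : topologicalType) : Prop :=
  exists d : X -> X -> R,
    [/\ forall x, d x x = 0,
        forall x y, d x y = 0 -> x = y,
        forall x y, d x y = d y x,
        forall y x z, d x z <= d x y + d y z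
      & forall x, nbhs x =
          filter_from [set e : R | 0 < e] (fun e => [set y | d x y < e])].

Definition Cp (R : realType) (X : topologicalType) : set {ptws X -> R} :=
  [set f | continuous (f : X -> R)].

Definition B1 (R : realType) (X : topologicalType) : set {ptws X -> R} :=
  [set f | exists u : nat -> X -> R,
     (forall n, continuous (u n)) /\
     (forall x, u n x @[n --> \oo] --> f x)].

Lemma Cp_sub_B1 (R : realType) (X : topologicalType) : @Cp R X `<=` @B1 R X.
Proof. by move=> f cf; exists (fun=> f); split=> // x; exact: cvg_cst. Qed.

(* The closure and the compactness are those of the space set_type Y, i.e. Y
   with the subspace topology, not those of the ambient space T. The preimage
   by set_val is A seen as a subset of set_type Y; this is meant for A `<=` Y. *)
Definition relatively_compact_in (T : topologicalType) (Y A : set T) : Prop :=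
  compact (closure (set_val @^-1` A : set (set_type Y))).

Definition pointwise_bounded_fun (R : realType) (X : Type)
    (A : set (X -> R)) : Prop :=
  forall x, exists M : R, 0 <= M /\ forall f, A f -> `|f x| <= M.

(* For B = set0 the intersections below are the whole of X. *)
Definition sublevel (R : realType) (X : Type) (B : set (X -> R)) (a : R) :
  set X := \bigcap_(f in B) (f @^-1` `]-oo, a]).

Definition superlevel (R : realType) (X : Type) (B : set (X -> R)) (a : R) :
  set X := \bigcap_(f in B) (f @^-1` `[a, +oo[).

Definition finitary_NIP (R : realType) (X : Type) (A : set (X -> R)) : Prop :=
  forall f : nat -> X -> R, (forall n, A (f n)) ->
  forall a b : R, a < b ->
  exists E F : set nat,
    [/\ finite_set E, finite_set F, E `&` F = set0
      & sublevel (f @` E) a `&` superlevel (f @` F) b = set0].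

Definition countable_NIP (R : realType) (X : Type) (A : set (X -> R)) : Prop :=
  forall f : nat -> X -> R, (forall n, A (f n)) ->
  forall a b : R, a < b ->
  exists E F : set nat,
    E `&` F = set0 /\
    sublevel (f @` E) a `&` superlevel (f @` F) b = set0.

Definition BFT_NIP (R : realType) (X : Type) (A : set (X -> R)) : Prop :=
  forall f : nat -> X -> R, (forall n, A (f n)) ->
  forall a b : R, a < b ->
  exists I : set nat,
    sublevel (f @` I) a `&` superlevel (f @` (~` I)) b = set0.

(* Main.v *)
Require Import Defs.
From HB Require Import structures.
From mathcomp Require Import all_boot all_order all_algebra.
From mathcomp Require Import all_classical all_reals all_analysis.
From mathcomp Require Import lra ring zify.

(** If A is relatively compact in B_1(X) and (f_n) violates BFT-NIP for a < b, a
    cluster point g of (f_n) is a limit of continuous functions u_k. The closed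
    sets where u_k <= (a+b)/2, resp. u_k >= (a+b)/2, for all k >= m, cover the
    points fitting the patterns in 2^N, so by Baire one of them fits a whole
    cylinder of patterns; extending the cylinder by the constant pattern of the
    opposite kind contradicts the choice of g.

    Conversely, let g be in the closure of A. By finitary NIP no nonempty closed
    F has both F /\ {g < a} and F /\ {b < g} dense in F, since an independent
    sequence could be built along such an F. Exhausting X by open sets gives,
    for all a < b, a gauge delta > 0 such that g x < a and b < g y never happen
    when d x y < min (delta x) (delta y). Gauges of oscillation 1/(m+1) for the
    bounded function G = g / (1 + |g|) then give G as the limit of the Lipschitz
    functions h_n x = inf (G y + 2/(m+1) + (n+1) d x y), the infimum being over
    the y and m such that the first m gauges exceed 2/(n+1) at y. *)

Set Implicit Arguments.
Unset Strict Implicit.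
Unset Printing Implicit Defensive.

Import Order.TTheory GRing.Theory Num.Theory.
Import numFieldNormedType.Exports.

Local Open Scope classical_set_scope.
Local Open Scope ring_scope.

(** * Cluster points and finite intersections in compact spaces *)

Lemma compact_seq_cluster (T : topologicalType) (K : set T) (x : nat -> T) :
  compact K -> (forall n, K (x n)) ->
  exists2 p, K p & forall B, nbhs p B -> forall N, exists2 n, (N <= n)%N & B (x n).
Proof.
move=> cK Kx.
have [|p [Kp clp]] := cK (x n @[n --> \oo]) _; first by exists 0%N => // n _; exact: Kx.
exists p => // B pB N.
have [] := clp (x @` [set n | N <= n]%N) B _ pB.
  by exists N => // n /= Nn; exists n.
by move=> _ [[n Nn <-] Bn]; exists n.
Qed.

Lemma compact_bigcap_nonempty (T : topologicalType) (C : nat -> set T) :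
  compact [set: T] -> (forall i, closed (C i)) ->
  (forall n, exists x, forall i, (i < n)%N -> C i x) ->
  exists x, forall i, C i x.
Proof.
move=> cT clC /choice[x Cx].
have [//|p _ clp] := compact_seq_cluster (x := x) cT.
exists p => i; apply: clC => B pB.
by have [n ni Bn] := clp _ pB i.+1; exists (x n); split=> //; exact: Cx.
Qed.

(** * Patterns of inequalities and the Baire argument *)

Section pattern_sets.
Variables (R : realType) (X : topologicalType).
Implicit Types (f : nat -> X -> R) (g : X -> R) (a b c : R).

Lemma closed_le_continuous g c : continuous g -> closed [set x | g x <= c].
Proof.
move=> cg; apply: (@closed_comp _ _ g [set y | y <= c]) => [x _|].
  exact: cg.
exact: closed_le.
Qed.

Lemma closed_ge_continuous g c : continuous g -> closed [set x | c <= g x].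
Proof.
move=> cg; apply: (@closed_comp _ _ g [set y | c <= y]) => [x _|].
  exact: cg.
exact: closed_ge.
Qed.

Definition fits f a b (s : pred nat) (x : X) (i : nat) : Prop :=
  if s i then f i x <= a else b <= f i x.

Lemma closed_fits f a b s i :
  continuous (f i) -> closed [set x | fits f a b s x i].
Proof.
rewrite /fits; case: (s i) => cf.
  exact: closed_le_continuous.
exact: closed_ge_continuous.
Qed.

(* Baire category argument in the space of patterns: the sets of patterns
   fitted by points of the [H m] are closed and cover the whole space. *)
Lemma closed_cover_cylinder f a b (H : nat -> set X) :
  compact [set: X] -> (forall i, continuous (f i)) ->
  (forall m, closed (H m)) ->
  (forall s, exists x m, H m x /\ forall i, fits f a b s x i) ->
  exists m k (s : pred nat), forall t : pred nat,
    (forall i, (i < k)%N -> t i = s i) ->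
    exists2 x, H m x & forall i, fits f a b t x i.
Proof.
move=> cX cf clH cov; apply: contrapT => nH.
(* Every cylinder contains a pattern [t] that no point of [H m] fits. By compactness a finite
   initial segment of [t] already excludes [H m], which gives a smaller cylinder. *)
have step (mp : nat * (nat * pred nat)) : exists q : nat * pred nat,
    [/\ (mp.2.1 <= q.1)%N, (forall i, (i < mp.2.1)%N -> q.2 i = mp.2.2 i) &
      forall x, H mp.1 x -> ~ forall i, (i < q.1)%N -> fits f a b q.2 x i].
  case: mp => m [k s] /=.
  have [t ts nt] : exists2 t : pred nat, (forall i, (i < k)%N -> t i = s i) &
      ~ exists2 x, H m x & forall i, fits f a b t x i.
    apply: contrapT => nt; apply: nH; exists m, k, s => t ts.
    by apply: contrapT => h; apply: nt; exists t.
  have [n nn] : exists n, forall x, H m x ->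
      ~ forall i, (i < n)%N -> fits f a b t x i.
    apply: contrapT => hn; apply: nt.
    have [|n|x Cx] := @compact_bigcap_nonempty X
      (fun i => H m `&` [set x | fits f a b t x i]) cX.
    - by move=> i; apply: closedI => //; exact: closed_fits.
    - apply: contrapT => hx; apply: hn; exists n => x Hx fx; apply: hx.
      by exists x => i /fx.
    by exists x => [|i]; [have [] := Cx 0%N|have [] := Cx i].
  exists (maxn k n, t); split=> //=; first exact: leq_maxl.
  move=> x Hx fx; apply: (nn x Hx) => i ilt; apply: fx.
  by rewrite leq_max ilt orbT.
have [h hP] := choice step.
pose st := fix st m : nat * pred nat :=
  if m is m'.+1 then h (m', st m') else (0%N, xpredT).
have stS m : st m.+1 = h (m, st m) by [].
have st_le m n : (m <= n)%N -> ((st m).1 <= (st n).1)%N /\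
    forall i, (i < (st m).1)%N -> (st n).2 i = (st m).2 i.
  elim: n => [|n ih]; first by rewrite leqn0 => /eqP ->.
  rewrite leq_eqVlt => /orP[/eqP -> //|/ih[le1 eq1]].
  have [le2 eq2 _] := hP (n, st n); rewrite stS; split=> [|i ilt].
    exact: leq_trans le1 le2.
  by rewrite eq2 ?eq1//=; exact: leq_trans ilt le1.
(* The common pattern of the nested cylinders. If no stage fixes entry [i], [get] returns a default,
   and the value of [t i] is irrelevant. *)
pose t i := (st (get [set m | i < (st m).1]%N)).2 i.
have tE m i : (i < (st m).1)%N -> t i = (st m).2 i.
  move=> ilt; rewrite /t; set m' := get _.
  have ilt' : (i < (st m').1)%N by apply: (@getPex _ [set m | i < (st m).1]%N); exists m.
  have [/st_le[_ ->]//|/ltnW/st_le[_ ->]//] := leqP m' m.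
have [x [m [Hx fx]]] := cov t.
have [_ _ nx] := hP (m, st m).
apply: (nx x Hx) => i ilt; have := fx i.
by rewrite /fits (tE m.+1) ?stS.
Qed.

End pattern_sets.

Lemma inv_succ_lt (R : realType) (e : R) :
  0 < e -> exists n, forall m, (n <= m)%N -> m.+1%:R^-1 < e.
Proof.
move=> e0; have [n _ h] := near_infty_natSinv_lt (PosNum e0).
by exists n => m nm; exact: h.
Qed.

Lemma ptws_eval_continuous (R : realType) (X : topologicalType) (x : X) :
  continuous (fun g : {ptws X -> R} => g x).
Proof. exact: (@proj_continuous X (fun=> R) x). Qed.

(** * From relative compactness to BFT-NIP, countable NIP and finitary NIP *)

Section NIP_implications.
Variables (R : realType) (X : topologicalType).
Implicit Types (f : nat -> X -> R) (a b : R).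

Lemma sub_superlevel_fits f a b (s : pred nat) x :
  (sublevel (f @` [set i | s i]) a `&`
     superlevel (f @` (~` [set i | s i])) b) x <->
  forall i, fits f a b s x i.
Proof.
split=> [[le ge] i|h].
  rewrite /fits; case: ifP => si.
    by have := le (f i); rewrite /= in_itv/=; apply; exists i.
  have := ge (f i); rewrite /= in_itv/= andbT; apply; exists i => //=.
  by rewrite si.
split=> _ [i /= si <-] /=; rewrite in_itv/= ?andbT; have := h i; rewrite /fits.
  by rewrite si.
by case: ifP.
Qed.

(** Clustering at one point at a time is enough: [g] is compared with the [f n] only at a single
    point fitting a pattern. *)
Lemma B1_cluster_BFT f a b (g : X -> R) :
  compact [set: X] -> (forall i, continuous (f i)) -> a < b -> B1 g ->
  (forall x e N, 0 < e -> exists2 n, (N <= n)%N & `|f n x - g x| < e) ->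
  exists I : set nat,
    sublevel (f @` I) a `&` superlevel (f @` (~` I)) b = set0.
Proof.
move=> cX cf ab [u [cu ug]] gcl; apply: contrapT => nI.
have cov (s : pred nat) : exists x, forall i, fits f a b s x i.
  apply: contrapT => h; apply: nI; exists [set i | s i].
  by rewrite -subset0 => x /sub_superlevel_fits hx; apply: h; exists x.
have gle x k (s : pred nat) : (forall i, fits f a b s x i) ->
    (forall i, (k <= i)%N -> s i) -> g x <= a.
  move=> fx sk; rewrite leNgt; apply/negP => agx.
  have [|n kn] := gcl x (g x - a) k; first by rewrite subr_gt0.
  have := fx n; rewrite /fits sk// => fna; rewrite ltr_norml => /andP[+ _].
  by rewrite opprB; lra.
have gge x k (s : pred nat) : (forall i, fits f a b s x i) ->
    (forall i, (k <= i)%N -> ~~ s i) -> b <= g x.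
  move=> fx sk; rewrite leNgt; apply/negP => agx.
  have [|n kn] := gcl x (b - g x) k; first by rewrite subr_gt0.
  have := fx n; rewrite /fits (negbTE (sk _ _))// => fna.
  by rewrite ltr_norml => /andP[_]; lra.
pose c := (a + b) / 2.
have [ac cb] : a < c /\ c < b by rewrite /c; split; lra.
(* At a fitted point all values [f n x] avoid the open interval from [a] to [b], so their cluster
   value [g x] cannot be its midpoint. *)
have gfits x s : (forall i, fits f a b s x i) -> g x != c.
  move=> fx; apply/eqP => gxc.
  pose e := Num.min (c - a) (b - c).
  have [|n _ fn] := gcl x e 0%N; first by rewrite lt_min !subr_gt0 ac.
  have := fn; rewrite gxc ltr_norml /e; have := fx n; rewrite /fits.
  case: ifP => _ ?; case: (leP (c - a) (b - c)) => ? /andP[]; lra.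
(* Parity merges the two families into one sequence. The index is also the threshold of the tail,
   harmlessly so because both [N.*2] and [N.*2.+1] are at least [N]. *)
pose H m := if odd m then [set x | forall k, (m <= k)%N -> c <= u k x]
  else [set x | forall k, (m <= k)%N -> u k x <= c].
have clH m : closed (H m).
  rewrite /H; case: ifP => _.
    rewrite [X in closed X](_ : _ =
      \bigcap_(k in [set k | (m <= k)%N]) [set x | c <= u k x])//.
    by apply: closed_bigI => k _; exact: closed_ge_continuous.
  rewrite [X in closed X](_ : _ =
    \bigcap_(k in [set k | (m <= k)%N]) [set x | u k x <= c])//.
  by apply: closed_bigI => k _; exact: closed_le_continuous.
have covH s : exists x m, H m x /\ forall i, fits f a b s x i.
  have [x fx] := cov s; exists x.
  have [gc|gc|gc] := ltgtP (g x) c; last by have := gfits _ _ fx; rewrite gc eqxx.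
  - have [N _ Nu] : \forall k \near \oo, u k x < c.
      exact: (cvgr_lt _ (ug x)).
    exists N.*2; split=> // ; rewrite /H odd_double => k kN; apply/ltW/Nu => /=.
    by apply: leq_trans kN; rewrite -addnn leq_addr.
  - have [N _ Nu] : \forall k \near \oo, c < u k x.
      exact: (cvgr_gt _ (ug x)).
    exists N.*2.+1; split=> // ; rewrite /H /= odd_double/= => k kN.
    apply/ltW/Nu => /=.
    by apply/ltnW; apply: leq_trans kN; rewrite ltnS -addnn leq_addr.
have [m [k [s sP]]] := closed_cover_cylinder cX cf clH covH.
have Hlim x : H m x -> if odd m then c <= g x else g x <= c.
  rewrite /H; case: ifP => _ h.
    by apply: cvgr_to_ge (ug x) _; exists m.
  by apply: cvgr_to_le (ug x) _; exists m.
(* Beyond [k] the pattern is continued by true when [g >= c] on [H m], which forces [g x <= a], and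
   by false when [g <= c], which forces [b <= g x]. *)
case mo : (odd m) Hlim => Hlim.
- have [|x /Hlim cx /gle ga] := sP (fun i => (i < k)%N ==> s i).
    by move=> i ->.
  have : g x <= a by apply: (ga k) => i; rewrite leqNgt => /negbTE ->.
  lra.
- have [|x /Hlim cx /gge gb] := sP (fun i => (i < k)%N && s i).
    by move=> i ->.
  have : b <= g x by apply: (gb k) => i; rewrite leqNgt => /negbTE ->.
  lra.
Qed.

Lemma relatively_compact_BFT (A : set {ptws X -> R}) :
  compact [set: X] -> A `<=` @Cp R X ->
  relatively_compact_in (@B1 R X) A -> BFT_NIP A.
Proof.
move=> cX AC rcA f Af a b ab.
have fB n : f n \in @B1 R X by apply/mem_set/Cp_sub_B1/AC/Af.
pose q n : set_type (@B1 R X) := exist _ (f n) (fB n).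
have [n|g _ gcl] := compact_seq_cluster (x := q) rcA.
  by apply: subset_closure; rewrite /= set_valE; exact: Af.
apply: (@B1_cluster_BFT _ _ _ (set_val g)) => //.
- by move=> i; exact: AC.
- exact: set_valP.
- move=> x e N e0.
  have [|n Nn] := gcl [set h | `|(set_val h : {ptws X -> R}) x - set_val g x| < e] _ N.
    have cont : continuous (fun h : set_type (@B1 R X) =>
        (set_val h : {ptws X -> R}) x).
      move=> h; apply: (@continuous_comp _ _ _ set_val
        (fun h : {ptws X -> R} => h x)); first exact: initial_continuous.
      exact: ptws_eval_continuous.
    have := cont g; move/(@cvgr_distC_lt _ _) => /(_ _ e0).
    exact.
  by exists n.
Qed.

Lemma BFT_countable (A : set (X -> R)) : BFT_NIP A -> countable_NIP A.
Proof.
move=> h f Af a b ab; have [I hI] := h f Af a b ab.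
by exists I, (~` I); rewrite setICr.
Qed.

(** By compactness, closed conditions indexed by the naturals that have no common solution already
    fail on some initial segment; [E] and [F] are truncated there. *)
Lemma countable_finitary (A : set (X -> R)) :
  compact [set: X] -> A `<=` [set f | continuous f] ->
  countable_NIP A -> finitary_NIP A.
Proof.
move=> cX Ac h f Af a b ab; have [E [F [EF0 EF]]] := h f Af a b ab.
pose C i := [set x | (E i -> f i x <= a) /\ (F i -> b <= f i x)].
have clC i : closed (C i).
  have cf := Ac _ (Af i).
  apply: closedI.
    have [Ei|nE] := pselect (E i); last first.
      by rewrite [X in closed X](_ : _ = setT)// -subTset => x _ /nE.
    rewrite [X in closed X](_ : _ = [set x | f i x <= a]).
      exact: closed_le_continuous.
    by apply/seteqP; split=> x /=; [exact|].
  have [Fi|nF] := pselect (F i); last first.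
    by rewrite [X in closed X](_ : _ = setT)// -subTset => x _ /nF.
  rewrite [X in closed X](_ : _ = [set x | b <= f i x]).
    exact: closed_ge_continuous.
  by apply/seteqP; split=> x /=; [exact|].
have [n nn] : exists n, forall x, ~ forall i, (i < n)%N -> C i x.
  apply: contrapT => hn.
  have [|x Cx] := compact_bigcap_nonempty cX clC.
    move=> n; apply: contrapT => hx; apply: hn; exists n => x Cx.
    by apply: hx; exists x.
  suff : set0 x by [].
  rewrite -EF; split=> _ [i Ei <-] /=; rewrite in_itv/= ?andbT.
    by have [+ _] := Cx i; exact.
  by have [_ +] := Cx i; exact.
exists (E `&` `I_n), (F `&` `I_n); split.
- exact/finite_setIr/finite_II.
- exact/finite_setIr/finite_II.
- by rewrite setIACA EF0 set0I.
- rewrite -subset0 => x [le ge]; apply: (nn x) => i ilt; split=> [Ei|Fi].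
    by have := le (f i); rewrite /= in_itv/=; apply; exists i.
  by have := ge (f i); rewrite /= in_itv/= andbT; apply; exists i.
Qed.

End NIP_implications.

(** Minima are unique in a well-order, and two elements below each other are both minima of the pair
    they form. This identifies chosen sets in [gauge_exhaustion]. *)
Lemma well_order_antisymmetric (T : eqType) (le : rel T) :
  wochoice.well_order le -> antisymmetric le.
Proof.
move=> wo x y /andP[xy yx].
have le_refl z : le z z.
  have [|v [[/eqP -> +] _]] := wo (pred1 z); first by exists z; rewrite inE.
  by apply; rewrite inE.
have [|z [_ zmin]] := wo (pred2 x y); first by exists x; rewrite !inE eqxx.
have xmin : wochoice.minimum_of le (pred2 x y) x.
  by split; rewrite ?inE ?eqxx// => _ /pred2P[]->.
have ymin : wochoice.minimum_of le (pred2 x y) y.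
  by split; rewrite ?inE ?eqxx ?orbT// => _ /pred2P[]->.
exact: etrans (esym (zmin _ xmin)) (zmin _ ymin).
Qed.

(** * Independent sequences built from a splitting closed set *)

Section independent_patterns.
Variables (R : realType) (X : topologicalType) (a b : R).
Implicit Types (h : X -> R) (l : seq (X -> R)) (s : seq bool).

Fixpoint strict_pattern l s : set X :=
  match l, s with
  | h :: l', e :: s' =>
      (if e then [set x | h x < a] else [set x | b < h x]) `&`
      strict_pattern l' s'
  | _, _ => setT
  end.

(** Openness is part of the invariant so that the splitting hypothesis applies to each pattern set
    without recalling that the members of [l] are continuous. *)
Definition independent_on (F : set X) l : Prop :=
  forall s, open (strict_pattern l s) /\
    (size s = size l -> F `&` strict_pattern l s !=set0).

Lemma closure_ptws_strict (A : set {ptws X -> R}) (g : {ptws X -> R})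
    (s : seq X) : closure A g ->
  exists2 h, A h & forall x, x \in s ->
    (g x < a -> h x < a) /\ (b < g x -> b < h x).
Proof.
move=> clAg.
suff /clAg [h [Ah hP]] : nbhs g [set h : {ptws X -> R} | forall x, x \in s ->
    (g x < a -> h x < a) /\ (b < g x -> b < h x)] by exists h.
elim: s => [|x s ih]; first by apply: filterE.
have cx : (fun h : {ptws X -> R} => h x) @ nbhs g --> g x.
  exact: ptws_eval_continuous.
have na : nbhs g [set h : {ptws X -> R} | g x < a -> h x < a].
  have [gxa|] := boolP (g x < a); last by move=> _; apply: filterE.
  by apply: filterS (cvgr_lt _ cx _ gxa) => h hx _.
have nb : nbhs g [set h : {ptws X -> R} | b < g x -> b < h x].
  have [gxb|] := boolP (b < g x); last by move=> _; apply: filterE.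
  by apply: filterS (cvgr_gt _ cx _ gxb) => h hx _.
apply: filterS (filterI (filterI na nb) ih) => h [[ha hb] hs] y.
by rewrite inE => /predU1P[->|/hs].
Qed.

(** Each full pattern set of [l] meets [F] both where [g < a] and where [b < g]. These are finitely
    many points, so one [h] in [A] imitates [g] at all of them and splits every pattern. *)
Lemma independent_extend (A : set {ptws X -> R}) (g : {ptws X -> R})
    (F : set X) l :
  A `<=` @Cp R X -> closure A g ->
  (forall V, open V -> F `&` V !=set0 ->
     exists x y, [/\ (F `&` V) x, (F `&` V) y, g x < a & b < g y]) ->
  independent_on F l -> exists2 h, A h & independent_on F (h :: l).
Proof.
move=> AC clAg split_g indl.
(* Tuples form a finite type, so [codom] lists all the chosen points. *)
have /choice[p pP] (s : (size l).-tuple bool) : exists xy : X * X,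
    [/\ (F `&` strict_pattern l s) xy.1, (F `&` strict_pattern l s) xy.2,
        g xy.1 < a & b < g xy.2].
  have [ol nel] := indl s.
  by have [||x [y xyP]] := split_g (strict_pattern l s);
    [|apply: nel; rewrite size_tuple|exists (x, y)].
have [h Ah hP] := closure_ptws_strict
  (codom (fst \o p) ++ codom (snd \o p)) clAg.
exists h => // -[|e s] /=; first by split=> //; exact: openT.
have ch : continuous h := AC _ Ah.
split=> [|[/eqP sl]].
  apply: openI; last by have [] := indl s.
  case: e.
    by apply: (@open_comp _ _ h [set y | y < a]) => [x _|]; [exact: ch|exact: open_lt].
  by apply: (@open_comp _ _ h [set y | b < y]) => [x _|]; [exact: ch|exact: open_gt].
have [[F1 s1] [F2 s2] g1 g2] := pP (@Tuple (size l) bool s sl).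
case: e.
  exists (p (@Tuple (size l) bool s sl)).1; split=> //; split=> //=.
  have [|+ _] := hP (p (@Tuple (size l) bool s sl)).1; last exact.
  by rewrite mem_cat (codom_f (fst \o p)).
exists (p (@Tuple (size l) bool s sl)).2; split=> //; split=> //=.
have [|_ +] := hP (p (@Tuple (size l) bool s sl)).2; last exact.
by rewrite mem_cat (codom_f (snd \o p)) orbT.
Qed.

Lemma NIP_no_splitting (A : set {ptws X -> R}) (g : {ptws X -> R}) (F : set X) :
  A `<=` @Cp R X -> finitary_NIP A -> closure A g -> a < b -> F !=set0 ->
  exists V, [/\ open V, F `&` V !=set0 &
    forall x y, (F `&` V) x -> (F `&` V) y -> ~ (g x < a /\ b < g y)].
Proof.
move=> AC nip clAg ab F0; apply: contrapT => nV.
have split_g V : open V -> F `&` V !=set0 ->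
    exists x y, [/\ (F `&` V) x, (F `&` V) y, g x < a & b < g y].
  move=> oV FV0; apply: contrapT => nxy; apply: nV; exists V; split=> // x y Fx Fy [].
  by move=> gx gy; apply: nxy; exists x, y.
(* [H] is total: on a list that is not independent it returns any member of [A], which is nonempty
   because its closure contains [g]. *)
have /choice[H HP] l : exists h, A h /\
    (independent_on F l -> independent_on F (h :: l)).
  have [/(independent_extend AC clAg split_g)[h Ah hl]|nl] :=
    pselect (independent_on F l); first by exists h.
  by have [h [Ah _]] := clAg _ filterT; exists h.
pose L n := iter n (fun l => H l :: l) [::].
have indL n : independent_on F (L n).
  elim: n => [|n ih]; last exact: (HP _).2.
  move=> s; split; first exact: openT.
  by move=> _ /=; rewrite setIT.
have [n|E [E' [finE finE' EE' dis]]] := nip (fun n => H (L n)) _ a b ab.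
  exact: (HP _).1.
have [N EN] : exists N, E `|` E' `<=` `I_N.
  have /finite_seqP[s Es] : finite_set (E `|` E') by rewrite finite_setU.
  exists (\max_(i <- s) i).+1; rewrite Es => i /= si.
  by rewrite ltnS; apply: leq_bigmax_seq.
(* Both [S n] and [L n] list the latest index first, so their entries correspond. Indices outside
   [E] and [E'] get false, a harmless choice. *)
pose S n := iteri n (fun i s => `[< E i >] :: s) [::].
have sizeSL n : size (S n) = size (L n) by elim: n => //= n ->.
have [_ /(_ (sizeSL N))[x [_ Sx]]] := indL N (S N).
have Hx : forall i, (i < N)%N -> if `[< E i >] then H (L i) x < a else b < H (L i) x.
  elim: N Sx {EN} => // N ih /= [hN /ih SN] i.
  rewrite ltnS leq_eqVlt => /predU1P[->|/SN//].
  by move: hN; case: ifP.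
suff : set0 x by [].
rewrite -dis; split=> _ [i Ei <-] /=; rewrite in_itv/= ?andbT.
  by have := Hx i (EN _ (or_introl Ei)); rewrite asboolT// => /ltW.
have nEi : ~ E i by move=> Ei'; have : (E `&` E') i by []; rewrite EE'.
by have := Hx i (EN _ (or_intror Ei)); rewrite asboolF// => /ltW.
Qed.

End independent_patterns.

(** * Gauges and their gluing along open sets *)

Section gauges.
Variables (R : realType) (X : topologicalType) (d : X -> X -> R).
Hypothesis dC : forall x y, d x y = d y x.
Hypothesis dnbhs : forall x, nbhs x =
  filter_from [set e : R | 0 < e] (fun e => [set y | d x y < e]).

Definition gauge_for (ok : X -> X -> Prop) (delta : X -> R) : Prop :=
  (forall x, 0 < delta x) /\
  forall x y, d x y < delta x -> d x y < delta y -> ok x y.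

(** The second clause makes gluing possible: a point within reach of a point of [U] cannot leave
    [U]. *)
Definition gauge_on (ok : X -> X -> Prop) (U : set X) (delta : X -> R) : Prop :=
  [/\ forall x, 0 < delta x,
      forall x y, U x -> d x y < delta x -> U y
    & forall x y, U x -> U y -> d x y < delta x -> d x y < delta y -> ok x y].

Lemma open_radius (U : set X) : open U ->
  exists r : X -> R, forall x, 0 < r x /\ (U x -> forall y, d x y < r x -> U y).
Proof.
move=> oU.
suff /choice[r rP] : forall x, exists r : R,
  0 < r /\ (U x -> forall y, d x y < r -> U y) by exists r.
move=> x.
have [Ux|nU] := pselect (U x); last by exists 1; split.
have := open_nbhs_nbhs (conj oU Ux); rewrite dnbhs => -[e /= e0 eU].
by exists e; split=> // _ y /eU.
Qed.

(* The union of all sets carrying a gauge carries one: a well-order on sets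
   assigns to each point the first such set containing it, and two points that
   see each other are assigned the same set. *)
Lemma gauge_exhaustion (ok : X -> X -> Prop) :
  (forall F, closed F -> F !=set0 -> exists V, [/\ open V, F `&` V !=set0 &
     forall x y, (F `&` V) x -> (F `&` V) y -> ok x y]) ->
  exists delta, gauge_for ok delta.
Proof.
move=> okF.
have [le wo] := wochoice.well_ordering_principle {classic (set X)}.
have le_anti := well_order_antisymmetric wo.
pose good U := exists delta, gauge_on ok U delta.
pose W := \bigcup_(U in good) U.
have /choice[u uP] x : exists U : set X, W x ->
    [/\ good U, U x & forall U' : set X, good U' -> U' x -> le U U'].
  have [Wx|] := pselect (W x); last by exists set0.
  have [|U [[Ux Umin] _]] := wo [pred U : {classic (set X)} | `[< good U /\ U x >]].
    by case: Wx => U gU Ux; exists U; apply/asboolP.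
  exists U => _; move: Ux => /asboolP[gU Ux]; split=> // U' gU' Ux'.
  by apply: Umin; apply/asboolP.
have /choice[D DP] (U : set X) : exists delta, good U -> gauge_on ok U delta.
  have [[delta]|] := pselect (good U); last by exists (fun=> 1).
  by exists delta.
pose dW x := if pselect (W x) then D (u x) x else 1.
have WE x : W x -> dW x = D (u x) x by rewrite /dW; case: pselect.
have gW : gauge_on ok W dW.
  split=> [x|x y Wx|x y Wx Wy].
  - rewrite /dW; case: pselect => // Wx.
    by have [/DP[+ _ _] _ _] := uP x Wx; exact.
  - rewrite WE// => dxy; have [gu ux _] := uP x Wx.
    by exists (u x) => //; have [_ + _] := DP _ gu; apply; [exact: ux|].
  - rewrite !WE// => dx dy.
    have [gx ux xmin] := uP x Wx; have [gy uy ymin] := uP y Wy.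
    have [_ Dx okx] := DP _ gx; have [_ Dy _] := DP _ gy.
    have uxy : u x y by exact: Dx dx.
    have uyx : u y x by apply: Dy uy _; rewrite dC.
    (* Each point lies in the set chosen for the other, so each chosen set precedes the other. *)
    have e : u x = u y by apply: le_anti; rewrite xmin// ymin.
    by apply: okx => //; rewrite {1}e.
(* Otherwise the complement of [W] is closed and nonempty, and a relatively open piece of it could
   be added to [W]. *)
have WT x : W x.
  apply: contrapT => nWx.
  have oW : open W.
    rewrite openE => y Wy; rewrite /interior dnbhs; exists (dW y).
      by have [+ _ _] := gW; exact.
    by move=> z; have [_ + _] := gW; exact.
  have [||V [oV [z [nWz Vz]] okV]] := okF (~` W).
  - exact: open_closedC.
  - by exists x.
  have [r rP] := open_radius oV.
  have [dW0 dWW dWok] := gW.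
  apply: nWz; exists (W `|` V); last by right.
  (* Mixed pairs never see each other: within [dW] of a point of [W] there are only points of
     [W]. *)
  pose e y := if pselect (W y) then dW y else r y.
  have eW y : W y -> e y = dW y by rewrite /e; case: pselect.
  have eV y : ~ W y -> e y = r y by rewrite /e; case: pselect.
  exists e; split=> [y|y1 y2|y1 y2].
  - by rewrite /e; case: pselect => ? /=; [exact: dW0|exact: (rP y).1].
  - move=> WV; have [Wy|nWy] := pselect (W y1).
      by rewrite eW// => /(dWW _ _ Wy); left.
    rewrite eV// => dr; right; case: WV => // Vy.
    exact: (rP y1).2 Vy _ dr.
  - case: (pselect (W y1)) => [Wy1|nWy1]; case: (pselect (W y2)) => [Wy2|nWy2].
    + by rewrite !eW// => _ _; exact: dWok.
    + by rewrite (eW y1)// => _ _ /(dWW _ _ Wy1).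
    + by rewrite (eW y2)// => _ _ _; rewrite dC => /(dWW _ _ Wy2).
    + by move=> [//|V1] [//|V2] _ _; exact: okV.
exists dW; have [dW0 _ dWok] := gW; split=> // x y; exact: dWok.
Qed.

End gauges.

(** * An increasing bijection of the line onto the interval (-1, 1) *)

Section squash.
Variable R : realType.
Implicit Types s t : R.

Definition squash t := t / (1 + `|t|).
Definition unsquash s := s / (1 - `|s|).

Lemma norm_squash_lt1 t : `|squash t| < 1.
Proof.
have t0 : 0 < 1 + `|t| by rewrite ltr_pwDl.
by rewrite normrM normfV (gtr0_norm t0) ltr_pdivrMr// mul1r ltrDr.
Qed.

Lemma squash_le s t : s <= t -> squash s <= squash t.
Proof.
move=> st; have pos u : 0 < 1 + `|u| :> R by rewrite ltr_pwDl.
rewrite /squash ler_pdivrMr// mulrAC ler_pdivlMr//.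
case: (ger0P s) => s0; case: (ger0P t) => t0; nra.
Qed.

Lemma squashK : cancel squash unsquash.
Proof.
move=> t; have t0 : 0 < 1 + `|t| by rewrite ltr_pwDl.
rewrite /unsquash /squash normrM normfV (gtr0_norm t0).
have -> : 1 - `|t| / (1 + `|t|) = (1 + `|t|)^-1 by field; rewrite gt_eqF.
by rewrite invrK divfK ?gt_eqF.
Qed.

Lemma unsquashK s : `|s| < 1 -> squash (unsquash s) = s.
Proof.
move=> s1; have s0 : 0 < 1 - `|s| by rewrite subr_gt0.
rewrite /unsquash /squash normrM normfV (gtr0_norm s0).
have -> : 1 + `|s| / (1 - `|s|) = (1 - `|s|)^-1 by field; rewrite gt_eqF.
by rewrite invrK divfK ?gt_eqF.
Qed.

End squash.

(** * Gauge separation implies Baire class 1 *)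

Section gauge_approximation.
Variables (R : realType) (X : topologicalType) (d : X -> X -> R).
Hypothesis d0 : forall x, d x x = 0.
Hypothesis dC : forall x y, d x y = d y x.
Hypothesis dtri : forall y x z, d x z <= d x y + d y z.
Hypothesis dnbhs : forall x, nbhs x =
  filter_from [set e : R | 0 < e] (fun e => [set y | d x y < e]).
Implicit Types (g G : X -> R) (a b e : R) (delta : X -> R).

Definition gauge_separated g : Prop := forall a b, a < b ->
  exists delta, gauge_for d (fun x y => ~ (g x < a /\ b < g y)) delta.

Lemma gauge_separated_squash g :
  gauge_separated g -> gauge_separated (@squash R \o g).
Proof.
move=> gs a b ab.
have bnd x : -1 < squash (g x) < 1 by rewrite -ltr_norml norm_squash_lt1.
(* Levels outside (-1, 1) make the condition vacuous; the others are pulled back by [unsquash]. *)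
have [a1|a1] := leP a (-1).
  exists (fun=> 1); split=> // x y _ _ [/= + _].
  by have /andP[+ +] := bnd x; lra.
have [b1|b1] := leP 1 b.
  exists (fun=> 1); split=> // x y _ _ [/= _].
  by have /andP[+ +] := bnd y; lra.
have aK : squash (unsquash a) = a
  by apply: unsquashK; rewrite ltr_norml; apply/andP; split; lra.
have bK : squash (unsquash b) = b
  by apply: unsquashK; rewrite ltr_norml; apply/andP; split; lra.
have squash_lt (s t : R) : squash s < squash t -> s < t.
  by move=> st; rewrite ltNge; apply/negP => /squash_le; rewrite leNgt st.
have [|delta [delta0 dP]] := gs (unsquash a) (unsquash b).
  by apply: squash_lt; rewrite aK bK.
exists delta; split=> // x y dx dy [/= gx gy]; apply: (dP x y dx dy).
by split; apply: squash_lt; rewrite ?aK ?bK.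
Qed.

(** A mesh of step [e / 2] on [-1, 1] needs finitely many gauges, whose minimum works: a jump of
    more than [e] skips a whole mesh interval. *)
Lemma gauge_oscillation G e : (forall x, `|G x| <= 1) -> 0 < e ->
  gauge_separated G ->
  exists delta, gauge_for d (fun x y => G y <= G x + e) delta.
Proof.
move=> G1 e0 Gs; pose p := e / 2.
have p0 : 0 < p by rewrite divr_gt0.
have mesh K : exists delta, gauge_for d (fun x y => forall j, (j < K)%N ->
    ~ (G x < -1 + j.+1%:R * p /\ -1 + j.+2%:R * p < G y)) delta.
  elim: K => [|K [delta [delta0 dP]]]; first by exists (fun=> 1); split.
  have [|eta [eta0 eP]] := Gs (-1 + K.+1%:R * p) (-1 + K.+2%:R * p).
    by rewrite ltrD2l ltr_pM2r// ltr_nat.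
  exists (fun x => Num.min (delta x) (eta x)); split=> [x|x y].
    by rewrite lt_min delta0 eta0.
  rewrite !lt_min => /andP[dx ex] /andP[dy ey] j.
  rewrite ltnS leq_eqVlt => /predU1P[->|jK]; first exact: eP.
  exact: dP.
(* Since [G x + 1 <= 2], the mesh index of [G x] is at most the truncation of [2 / p]. *)
have [delta [delta0 dP]] := mesh (Num.truncn (2 / p)).+1.
exists delta; split=> // x y dx dy; rewrite leNgt; apply/negP => Gxy.
have /andP[Gx1 Gx2] : -1 <= G x <= 1 by rewrite -ler_norml.
have Gp : 0 <= (G x + 1) / p by rewrite divr_ge0 ?(ltW p0)//; lra.
pose k := Num.truncn ((G x + 1) / p).
have /andP[kle klt] : k%:R * p <= G x + 1 < k.+1%:R * p.
  by rewrite -ler_pdivlMr// -ltr_pdivrMr// truncn_itv.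
have k2 : k.+2%:R * p = k%:R * p + e.
  by rewrite -addn2 natrD mulrDl /p [2 * _]mulrC divfK.
apply: (dP x y dx dy k).
  by rewrite ltnS; apply: le_truncn; rewrite ler_pM2r ?invr_gt0//; lra.
split; first by rewrite addrC ltrBrDr.
by apply: le_lt_trans Gxy; rewrite k2; lra.
Qed.

Lemma gauge_separated_B1 g : gauge_separated g -> B1 g.
Proof.
move=> gs; pose G := @squash R \o g.
have G1 x : `|G x| < 1 by exact: norm_squash_lt1.
have Gb x : -1 < G x < 1 by rewrite -ltr_norml.
have /choice[eta etaP] m : exists delta,
    gauge_for d (fun x y => G y <= G x + m.+1%:R^-1) delta.
  apply: gauge_oscillation => //; last exact: gauge_separated_squash.
  by move=> x; exact: ltW.
have dge0 x y : 0 <= d x y.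
  have := dtri y x x; rewrite d0 (dC y x) => h; lra.
pose fine n m y := forall j, (j < m)%N -> 2 / n.+1%:R < eta j y.
(* At distance at least [2 / n.+1%:R] the penalty is at least 2 and outweighs any drop of [G]. At
   smaller distances the gauges control [G x - G y], and [2 / m.+1%:R] absorbs the error they
   leave. *)
pose S n x := [set t | exists y m, fine n m y /\
  t = G y + 2 / m.+1%:R + n.+1%:R * d x y].
have Slb n x : lbound (S n x) (-1).
  move=> _ [y [m [_ ->]]].
  have /andP[+ _] := Gb y; have : 0 <= 2 / m.+1%:R :> R by [].
  have : 0 <= n.+1%:R * d x y by rewrite mulr_ge0.
  by move: (2 / _) (_ * d x y) => u v; lra.
have Shlb n x : has_lbound (S n x) by exists (-1).
have Sne n x : S n x !=set0.
  by exists (G x + 2 / 1%:R + n.+1%:R * d x x), x, 0%N; split.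
pose h n x := inf (S n x).
have hlip n x z : h n x <= h n z + n.+1%:R * d x z.
  rewrite -lerBlDr; apply: lb_le_inf; first exact: Sne.
  move=> _ [y [m [fy ->]]]; rewrite lerBlDr.
  apply: (@le_trans _ _ (G y + 2 / m.+1%:R + n.+1%:R * d x y)).
    by apply: ge_inf; [exact: Shlb|exists y, m].
  rewrite -[leRHS]addrA lerD2l -mulrDr ler_pM2l// addrC; exact: dtri.
have hcont n : continuous (h n).
  move=> x; apply/cvgrPdist_lt => e e0.
  suff : nbhs x [set z | `|h n x - h n z| < e] by [].
  rewrite dnbhs.
  exists (e / n.+1%:R); first by rewrite /= divr_gt0.
  move=> z /=; rewrite ltr_pdivlMr// mulrC => xz.
  have := hlip n x z; have := hlip n z x; rewrite (dC z x) => h1 h2.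
  by rewrite ltr_norml; apply/andP; split; lra.
have fine_near x M : exists N, forall n, (N <= n)%N -> fine n M x.
  elim: M => [|M [N NP]]; first by exists 0%N.
  have [|N' N'P] := @inv_succ_lt R (eta M x / 2).
    by rewrite divr_gt0//; have [] := etaP M.
  exists (maxn N N') => n; rewrite geq_max => /andP[Nn N'n] j.
  rewrite ltnS leq_eqVlt => /predU1P[->|jM]; last exact: NP.
  by have := N'P n N'n; move: (n.+1%:R^-1) => u; lra.
have hG x : h n x @[n --> \oo] --> G x.
  apply/cvgrPdist_lt => e e0.
  have [|M MP] := @inv_succ_lt R (e / 2); first by rewrite divr_gt0.
  have {MP}Me := MP M (leqnn M).
  (* One gauge more than the upper bound needs: the lower bound also uses gauge [M] at [x]. *)
  have [N NP] := fine_near x M.+1.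
  exists N => // n /= /NP fx.
  have hle : h n x <= G x + 2 / M.+1%:R.
    apply: ge_inf; first exact: Shlb.
    exists x, M; split; last by rewrite d0 mulr0 addr0.
    by move=> j jM; apply: fx; rewrite ltnS ltnW.
  have hge : G x - M.+1%:R^-1 <= h n x.
    apply: lb_le_inf; first exact: Sne.
    move=> _ [y [m [fy ->]]].
    have Mpos : 0 < M.+1%:R^-1 :> R by [].
    have mpos : 0 < m.+1%:R^-1 :> R by [].
    have npos : 0 < n.+1%:R :> R by [].
    have dpos : 0 <= n.+1%:R * d x y by rewrite mulr_ge0.
    have /andP[Gx1 Gx2] := Gb x; have /andP[Gy1 Gy2] := Gb y.
    have [far|near] := leP (2 / n.+1%:R) (d x y).
      move: far; rewrite ler_pdivrMr// [d x y * _]mulrC.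
      move: (_ * d x y) (M.+1%:R^-1) (m.+1%:R^-1) dpos Mpos mpos => u v w.
      by lra.
    have close k : (k < m)%N -> (k <= M)%N -> G x <= G y + k.+1%:R^-1.
      move=> km kM; have [_ + ] := etaP k; apply; rewrite dC.
        by apply: lt_trans near _; exact: fy.
      by apply: lt_trans near _; exact: fx.
    move: (_ * d x y) dpos => u dpos.
    (* With no gauge at [y] the term 2 covers the range of [G]. Otherwise the last gauge of [y] is
       used if its index is at most [M], and gauge [M] if not. *)
    case: m fy mpos close => [_ _ _|m fy mpos close].
      by rewrite divr1; move: (M.+1%:R^-1) Mpos => v Mpos; lra.
    have [mM|Mm] := leqP m M.
      have := close m (ltnSn m) mM.
      have : m.+1%:R^-1 <= 2 / m.+2%:R :> R.
        rewrite -[leLHS]mul1r ler_pdivrMr// mulrAC ler_pdivlMr// mul1r.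
        by rewrite -natrM ler_nat; lia.
      move: (m.+1%:R^-1) (2 / _) (M.+1%:R^-1) Mpos => v w z.
      by lra.
    have := close M (ltnW Mm) (leqnn M).
    move: (m.+2%:R^-1) (M.+1%:R^-1) mpos => v w.
    by lra.
  move: hge hle Me; have : 0 < M.+1%:R^-1 :> R by [].
  move: (M.+1%:R^-1) => v *.
  by rewrite ltr_norml; apply/andP; split; lra.
(* [h n] may leave (-1, 1), so the denominator of [unsquash] is kept positive; at each point the
   correction eventually disappears because [|G x| < 1]. *)
pose den n x := Num.max (1 - `|h n x|) n.+1%:R^-1.
have den0 n x : 0 < den n x by rewrite /den lt_max invr_gt0 ltr0Sn orbT.
exists (fun n x => h n x / den n x); split=> [n x|x].
  apply: continuousM; first exact: hcont.
  apply: continuousV; first by rewrite gt_eqF.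
  apply: (@continuous_max _ _ (fun x => 1 - `|h n x|) (fun=> n.+1%:R^-1)).
    apply: continuousB; first exact: cst_continuous.
    by apply: continuous_comp; [exact: hcont|exact: norm_continuous].
  exact: cst_continuous.
have gE : g x = G x / (1 - `|G x|) by rewrite -[LHS]squashK.
rewrite gE; apply: cvgM; first exact: hG.
apply: cvgV; first by rewrite gt_eqF// subr_gt0.
have lim1 : (1 - `|h n x|) @[n --> \oo] --> 1 - `|G x|.
  by apply: cvgB; [exact: cvg_cst|exact: cvg_norm].
apply: cvg_trans lim1; apply: near_eq_cvg.
pose c := (1 - `|G x|) / 2.
have c0 : 0 < c by rewrite divr_gt0// subr_gt0.
have [N NP] := inv_succ_lt c0.
have [N' _ N'P] : \forall n \near \oo, `|h n x| < 1 - c.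
  apply: (cvgr_norm_lt _ (hG x)); rewrite /c; have := G1 x; lra.
exists (maxn N N') => // n /=; rewrite geq_max => /andP[/NP Nn /N'P /= hn].
by rewrite /den max_l//; move: (n.+1%:R^-1) Nn => v; lra.
Qed.

End gauge_approximation.

(** * Compact closures and the final implication *)

Lemma pointwise_bounded_compact_closure (R : realType) (X : topologicalType)
    (A : set {ptws X -> R}) :
  pointwise_bounded_fun A -> compact (closure A).
Proof.
move=> /choice[M MP].
pose K x := [set` `[- M x, M x]].
have cK : compact [set f : {ptws X -> R} | forall x, K x (f x)].
  by apply: (@tychonoff X (fun=> R)) => x; exact: segment_compact.
apply: subclosed_compact cK _; first exact: closed_closure.
move=> g clAg x.
have : closed (K x) by rewrite /K; exact: interval_closed.
apply; apply: (closureS (A := (fun f : {ptws X -> R} => f x) @` A)).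
  move=> _ [f Af <-]; rewrite /K /= in_itv/= -ler_norml.
  by have [_] := MP x; exact.
move=> B /ptws_eval_continuous /clAg [f [Af Bf]].
by exists (f x); split=> //; exists f.
Qed.

(** A filter on [Y] is pushed to the ambient space, where it clusters at a point of [closure A],
    hence of [Y]; the subspace topology brings the cluster point back. *)
Lemma relatively_compact_in_subset (T : topologicalType) (Y A : set T) :
  compact (closure A) -> closure A `<=` Y -> relatively_compact_in Y A.
Proof.
move=> cA AY F PF FA.
have clval (q : set_type Y) :
    closure (set_val @^-1` A : set (set_type Y)) q -> closure A (set_val q).
  move=> clq B /initial_continuous /clq [z [Az Bz]].
  by exists (set_val z).
have [|p [clp clFp]] := cA (set_val @ F) _.
  suff : F (set_val @^-1` closure A) by [].
  by apply: filterS FA => q /clval.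
pose q : set_type Y := exist _ p (mem_set (AY _ clp)).
have clFq : cluster F q.
  move=> B C FB [_ [[U oU <-] Uq UC]].
  have [||_ [[z Bz <-] Uz]] := clFp (set_val @` B) U.
  - suff : F (set_val @^-1` (set_val @` B)) by [].
    by apply: filterS FB => z Bz; exists z.
  - exact: open_nbhs_nbhs.
  by exists z; split=> //; exact: UC.
exists q; split=> //; apply: closed_closure => B qB.
exact: clFq FA qB.
Qed.

Lemma finitary_NIP_closure_B1 (R : realType) (X : topologicalType)
    (A : set {ptws X -> R}) :
  metrizable R X -> A `<=` @Cp R X -> finitary_NIP A -> closure A `<=` @B1 R X.
Proof.
move=> [d [d0 _ dC dtri dnbhs]] AC nip g clAg.
apply: (gauge_separated_B1 d0 dC dtri dnbhs) => a b ab.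
apply: gauge_exhaustion dC dnbhs _ _ => F clF F0.
exact: NIP_no_splitting AC nip clAg ab F0.
Qed.

Theorem theorem1p8 (R : realType) (X : topologicalType)
  (X_compact : compact [set: X]) (X_metrizable : metrizable R X)
  (A : set {ptws X -> R}) (A_sub_Cp : A `<=` @Cp R X)
  (A_bounded : pointwise_bounded_fun A) :
  [<-> relatively_compact_in (@B1 R X) A;
       BFT_NIP A;
       countable_NIP A;
       finitary_NIP A].
Proof.
tfae.
- exact: relatively_compact_BFT.
- exact: BFT_countable.
- exact: countable_finitary.
- move=> nip; apply: relatively_compact_in_subset.
    exact: pointwise_bounded_compact_closure.
  exact: finitary_NIP_closure_B1.
Qed.
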